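(* Let $f,g_1,\ldots,g_m\in\mathcal V_r$, and assume that $K=\{(x,\lambda)\in\mathbb R^n\times\mathbb R^r:g_i(x,\lambda)\ge0,\ i=1,\ldots,m\}$ is nonempty. Let $f_{\min}$ be the optimal value of minimizing $f$ over $K$, and for $d\ge d_{\min}$ let $$f_d=\sup\{\gamma\in\mathbb R:f-\gamma\in\mathcal M_{x,d}(g)\}.$$ Then $f_d\le f_{d+1}\le f_{\min}$ for all $d\ge d_{\min}$. Moreover, if $\mathcal M_x(g)$ is restricted Archimedean, then $\lim_{d\to\infty}f_d=f_{\min}$.
   Context: Here $x=(x_1,\ldots,x_n)$, $\lambda=(\lambda_1,\ldots,\lambda_r)$. $\mathcal V_r=\{p_0(x)+\sum_{k=1}^r\lambda_k p_k(x): p_0,\ldots,p_r\in\mathbb R[x]\}$. $\Sigma[x]$ is the cone of finite sums of squares in $\mathbb R[x]$, and $\Sigma[x]_{\le 2d}$ is its subset of polynomials of degree at most $2d$. $\mathcal M_x(g)=\{\sigma_0+\sum_{i=1}^m\sigma_i g_i:\sigma_0,\ldots,\sigma_m\in\Sigma[x]\}$; it is restricted Archimedean if for every $p\in\mathcal V_r$ there is $N>0$ with $N+p,\ N-p\in\mathcal M_x(g)$. For $p=p_0+\sum_k\lambda_kp_k\in\mathcal V_r$, $\deg_xp=\max_{0\le k\le r}\deg p_k$. Put $d_i=\lceil\deg_xg_i/2\rceil$ and $d_{\min}=\max\{\lceil\deg_xf/2\rceil,d_1,\ldots,d_m\}$. For $d\ge d_{\min}$ the truncated restricted quadratic module is $\mathcal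 M_{x,d}(g)=\{\sigma_0+\sum_{i=1}^m\sigma_ig_i:\sigma_0\in\Sigma[x]_{\le2d},\ \sigma_i\in\Sigma[x]_{\le2(d-d_i)}\}$. The optimal value $f_{\min}$ is $\inf_{(x,\lambda)\in K}f(x,\lambda)$, and $\sup\varnothing=-\infty$. *)

(* Defs.v *)
From HB Require Import structures.
From mathcomp Require Import all_boot all_order all_algebra.
(* mpoly has to be imported before the analysis files: in the other order
   their reserved notations clash. *)
From mathcomp Require Import mpoly.
From mathcomp Require Import classical_sets reals constructive_ereal ereal.
From mathcomp Require Import topology normedtype sequences.

Set Implicit Arguments.
Unset Strict Implicit.
Unset Printing Implicit Defensive.

Import Order.TTheory GRing.Theory Num.Theory.
Import numFieldNormedType.Exports.

Local Open Scope classical_set_scope.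
Local Open Scope ring_scope.

(* R[x, lambda] is represented as R[x][lambda], with x = (x_1, ..., x_n) and
   lambda = (lambda_1, ..., lambda_r). *)
Notation "{ 'xlpoly' R [ n , r ] }" := {mpoly {mpoly R[n]}[r]}
  (at level 0, R at level 2, n at level 2, r at level 2,
   format "{ 'xlpoly'  R [ n ,  r ] }") : type_scope.

(* The degree of 0 is taken to be 0. *)
Definition tdeg (R : realType) (n : nat) (p : {mpoly R[n]}) : nat :=
  (msize p).-1.

Definition affine_lambda (R : realType) (n r : nat) : set {xlpoly R[n, r]} :=
  [set p | exists (p0 : {mpoly R[n]}) (q : 'I_r -> {mpoly R[n]}),
     p = p0%:MP + \sum_(k < r) 'X_k * (q k)%:MP].

(* For p = p_0 + \sum_k lambda_k p_k, the coefficients of p (as a polynomial in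
   lambda) at the monomials 1 and lambda_k are p_0 and p_k. *)
Definition degx (R : realType) (n r : nat) (p : {xlpoly R[n, r]}) : nat :=
  maxn (tdeg p@_0%MM) (\max_(k < r) tdeg p@_(U_(k)%MM)).

Definition evalxl (R : realType) (n r : nat) (p : {xlpoly R[n, r]})
    (x : 'rV[R]_n) (l : 'rV[R]_r) : R :=
  p.@[fun k => (l ord0 k)%:MP].@[x ord0].

Definition sos (R : realType) (n : nat) : set {mpoly R[n]} :=
  [set s | exists qs : seq {mpoly R[n]}, s = \sum_(q <- qs) q ^+ 2].

Definition sos_le (R : realType) (n e : nat) : set {mpoly R[n]} :=
  [set s | sos s /\ (tdeg s <= e)%N].

Section RestrictedModule.
Variables (R : realType) (n r m : nat).
Implicit Types (f p : {xlpoly R[n, r]}) (g : 'I_m -> {xlpoly R[n, r]}).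

Definition feasible g : set ('rV[R]_n * 'rV[R]_r) :=
  [set xl | forall i, 0 <= evalxl (g i) xl.1 xl.2].

Definition fmin f g : \bar R :=
  ereal_inf [set (evalxl f xl.1 xl.2)%:E | xl in feasible g].

Definition qmodule g : set {xlpoly R[n, r]} :=
  [set p | exists (s0 : {mpoly R[n]}) (s : 'I_m -> {mpoly R[n]}),
     [/\ sos s0, forall i, sos (s i) &
         p = s0%:MP + \sum_(i < m) (s i)%:MP * g i]].

Definition restricted_archimedean g : Prop :=
  forall p, affine_lambda p -> exists N : R,
    [/\ 0 < N, qmodule g (N%:MP%:MP + p) & qmodule g (N%:MP%:MP - p)].

(* uphalf k is the ceiling of k / 2 *)
Definition halfdegx p : nat := uphalf (degx p).

Definition dmin f g : nat :=
  maxn (halfdegx f) (\max_(i < m) halfdegx (g i)).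

(* Meant for d >= dmin f g, where the subtractions are not truncated. *)
Definition tqmodule g (d : nat) : set {xlpoly R[n, r]} :=
  [set p | exists (s0 : {mpoly R[n]}) (s : 'I_m -> {mpoly R[n]}),
     [/\ sos_le (2 * d) s0,
         forall i, sos_le (2 * (d - halfdegx (g i))) (s i) &
         p = s0%:MP + \sum_(i < m) (s i)%:MP * g i]].

Definition fsup f g (d : nat) : \bar R :=
  ereal_sup [set gamma%:E | gamma in
    [set gamma : R | tqmodule g d (f - gamma%:MP%:MP)]].

End RestrictedModule.

(* Main.v *)
Require Import Defs.
From HB Require Import structures.
From mathcomp Require Import all_boot all_order all_algebra.
From mathcomp Require Import mpoly.
From mathcomp Require Import boolp classical_sets reals constructive_ereal ereal.
From mathcomp Require Import topology normedtype sequences.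
From mathcomp Require Import ring.

Set Implicit Arguments.
Unset Strict Implicit.
Unset Printing Implicit Defensive.

Import Order.TTheory GRing.Theory Num.Theory.
Import numFieldNormedType.Exports.

Local Open Scope classical_set_scope.
Local Open Scope ring_scope.

(** Convergence reduces to a Positivstellensatz: a polynomial p affine in
    lambda and positive on K lies in the module M. If -1 = q - t p with q in M
    and t a sum of squares, then p is in M by an elementary identity. Otherwise
    Zorn's lemma gives a maximal proper module Q containing M and -p. As in the
    Kadison-Dubois theorem, maximality and the Archimedean property make Q total
    on the affine polynomials, and phi v = sup {c | v - c in Q} is then linear
    and satisfies phi (a v) = phi a * phi v for a in R[x]. Such a phi is
    evaluation at the point with coordinates phi x_k and phi lambda_k; this
    point lies in K, and p is not positive there. *)

(** Over [{mpoly R[n]}] this unfolds to [sos], so the closure lemmas below serve both the abstract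
    argument and the concrete module. *)
Definition sum_sq (A : comNzRingType) : set A :=
  [set s | exists qs : seq A, s = \sum_(q <- qs) q ^+ 2].

Lemma sum_sq0 (A : comNzRingType) : sum_sq (0 : A).
Proof. by exists [::]; rewrite big_nil. Qed.

Lemma sum_sq_sqr (A : comNzRingType) (a : A) : sum_sq (a ^+ 2).
Proof. by exists [:: a]; rewrite big_seq1. Qed.

Lemma sum_sqD (A : comNzRingType) (s t : A) :
  sum_sq s -> sum_sq t -> sum_sq (s + t).
Proof. by move=> [qs ->] [rs ->]; exists (qs ++ rs); rewrite big_cat. Qed.

Lemma sum_sqM (A : comNzRingType) (a s : A) :
  sum_sq s -> sum_sq (a ^+ 2 * s).
Proof.
move=> [qs ->]; exists [seq a * q | q <- qs].
by rewrite big_map mulr_sumr; apply: eq_bigr => q _; rewrite exprMn.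
Qed.

(** * Quadratic modules relative to a subring, and cancellation of a multiplier *)

Section QuadraticModules.
Variables (R : realType) (A T : comNzRingType).
Variables (i : {rmorphism R -> A}) (j : {rmorphism A -> T}).
Implicit Types (Q M : set T) (c : R) (a s t : A) (u v w p : T).

(* The scalars a ranging over A only, this is a quadratic module of T
   relative to the subring A. *)
Definition qmod Q := [/\ Q 1, forall u v, Q u -> Q v -> Q (u + v) &
  forall a u, Q u -> Q (j a ^+ 2 * u)].

Lemma qmod0 Q : qmod Q -> Q 0.
Proof. by move=> [Q1 _ QM]; have := QM 0 _ Q1; rewrite rmorph0 expr0n mul0r. Qed.

Lemma qmod_sumsq Q s u : qmod Q -> sum_sq s -> Q u -> Q (j s * u).
Proof.
move=> qQ [qs ->] Qu; have Q0 := qmod0 qQ; case: qQ => _ QD QM.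
rewrite rmorph_sum mulr_suml; apply: (big_ind Q) => // q _.
by rewrite rmorphXn; apply: QM.
Qed.

Lemma qmod_scale Q c u : qmod Q -> 0 <= c -> Q u -> Q (j (i c) * u).
Proof.
move=> [_ _ QM] c0 Qu.
by rewrite -(sqr_sqrtr c0) !rmorphXn; apply: QM.
Qed.

Lemma qmod_const Q c : qmod Q -> 0 <= c -> Q (j (i c)).
Proof. by move=> qQ c0; rewrite -[j _]mulr1; apply: qmod_scale => //; case: qQ. Qed.

Lemma qmod_unscale Q c u : qmod Q -> 0 < c -> Q (j (i c) * u) -> Q u.
Proof.
move=> qQ c0 /(qmod_scale (c := c^-1) qQ).
rewrite mulrA -!rmorphM mulVf ?gt_eqF// !rmorph1 mul1r; apply.
by rewrite invr_ge0 ltW.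
Qed.

(** A negative constant in [Q] could be rescaled to -1. *)
Lemma qmod_proper_const Q c : qmod Q -> ~ Q (- 1) -> Q (j (i c)) -> 0 <= c.
Proof.
move=> qQ Qproper Qc; rewrite leNgt; apply/negP => c0; apply: Qproper.
apply: (@qmod_unscale _ (- c)) => //; first by rewrite oppr_gt0.
by rewrite mulrN1 !rmorphN opprK.
Qed.

Variable V : set T.
Hypotheses (V1 : V 1) (VD : forall u v, V u -> V v -> V (u + v))
  (VM : forall a v, V v -> V (j a * v)).

Lemma V_range a : V (j a).
Proof. by rewrite -[j a]mulr1; apply: VM. Qed.

Lemma V_opp v : V v -> V (- v).
Proof. by move=> /(VM (-1)); rewrite rmorphN1 mulN1r. Qed.

(** Only elements of [V] are bounded. In the application [V] is the set of polynomials affine in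
    lambda, which need not be closed under products. *)
Definition archimedean_on Q := forall v, V v -> exists N : R,
  [/\ 0 < N, Q (j (i N) + v) & Q (j (i N) - v)].

(* Replacing p by (N - t)^2 p, which is still controlled by t p >= 1, lowers
   the constant rho by the fixed amount 1/N. *)
Lemma archimedean_cancel M p t : qmod M -> archimedean_on M -> V p ->
  sum_sq t -> M (j t * p - 1) -> M p.
Proof.
move=> qM archM Vp sqt Mtp; have [M1 MD MM] := qM.
have [N [N0 MN MNt]] : exists N : R, [/\ 0 < N, M (j (i N) - j t ^+ 2 * p) &
    M (j (i N) - j t)].
  have [|N1 [N10 _ MN1]] := archM (j t ^+ 2 * p).
    by rewrite -rmorphXn; apply: VM.
  have [|N2 [N20 _ MN2]] := archM (j t); first exact: V_range.
  exists (N1 + N2); split; first exact: addr_gt0.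
    by rewrite !rmorphD /= addrAC; apply/MD => //; apply: qmod_const => //; apply: ltW.
  by rewrite !rmorphD /= -addrA; apply/MD => //; apply: qmod_const => //; apply: ltW.
have step rho : 0 <= rho -> M (p + j (i rho)) -> M (p + j (i (rho - N^-1))).
  move=> rho0 Mrho; apply: (@qmod_unscale _ (N ^+ 2)) => //.
    exact: exprn_gt0.
  (* The terms -2Ntp and t^2 p of the square are cancelled by 2N(tp - 1) and N - t^2 p, whose
     constants leave -N, that is -1/N after division by N^2. The summand with factor rho t absorbs
     the remaining terms in rho. *)
  have -> : j (i (N ^+ 2)) * (p + j (i (rho - N^-1))) =
      (j (i N - t)) ^+ 2 * (p + j (i rho)) + j (i (2 * N)) * (j t * p - 1)
      + j (i rho) * (j t * (j (i N) - j t + j (i N)))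
      + (j (i N) - j t ^+ 2 * p).
    have NN : j (i N) * j (i N) * j (i N^-1) = j (i N).
      by rewrite -!rmorphM mulfK // gt_eqF.
    by rewrite !(rmorphB, rmorphM, rmorphXn) !rmorph_nat; ring: NN.
  apply/MD => //; apply/MD.
    apply/MD; first exact: MM.
    by apply: qmod_scale => //; apply: mulr_ge0 => //; apply: ltW.
  apply: qmod_scale => //; apply: qmod_sumsq => //; apply/MD => //.
  by apply: qmod_const => //; apply: ltW.
(* Here [k] bounds the number of steps of length 1/N that bring rho down to 0 or below. *)
have descent k : forall rho, rho <= k%:R / N -> M (p + j (i rho)) -> M p.
  have base rho : rho <= 0 -> M (p + j (i rho)) -> M p.
    move=> rho0 Mrho; rewrite -[p](addrK (j (i rho))) -!rmorphN.
    by apply/MD => //; apply: qmod_const => //; rewrite oppr_ge0.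
  elim: k => [|k IH] rho; first by rewrite mul0r; apply: base.
  move=> lerho Mrho; have [rho0|/ltW rho0] := leP 0 rho; last exact: base Mrho.
  apply: (IH (rho - N^-1)); last exact: step.
  by rewrite lerBlDr -[X in _ + X]mul1r -mulrDl -natr1 in lerho *.
have [rho [rho0 Mrho _]] := archM _ Vp.
apply: (descent (Num.bound (rho * N)) rho); last by rewrite addrC.
rewrite ler_pdivlMr //; apply/ltW/archi_boundP.
by apply: mulr_ge0; apply: ltW.
Qed.

(** * Adjoining an element, and maximal proper modules *)

Definition qmod_adjoin Q v : set T :=
  [set w | exists q s, [/\ Q q, sum_sq s & w = q + j s * v]].

Lemma qmod_adjoinP Q v : qmod Q -> qmod (qmod_adjoin Q v).
Proof.
move=> qQ; have [Q1 QD QM] := qQ; split.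
- by exists 1, 0; split=> //; [exact: sum_sq0 | rewrite rmorph0 mul0r addr0].
- move=> _ _ [q [s [Qq ss ->]]] [q' [s' [Qq' ss' ->]]].
  exists (q + q'), (s + s'); split; [exact: QD|exact: sum_sqD|].
  by rewrite rmorphD mulrDl addrACA.
- move=> a _ [q [s [Qq ss ->]]].
  exists (j a ^+ 2 * q), (a ^+ 2 * s); split; [exact: QM|exact: sum_sqM|].
  by rewrite rmorphM rmorphXn mulrDr mulrA.
Qed.

Lemma sub_qmod_adjoin Q v : Q `<=` qmod_adjoin Q v.
Proof.
by move=> q Qq; exists q, 0; split=> //; [exact: sum_sq0 | rewrite rmorph0 mul0r addr0].
Qed.

Lemma qmod_adjoin_id Q v : qmod Q -> qmod_adjoin Q v v.
Proof.
move=> /qmod0 Q0; exists 0, 1; split=> //; last by rewrite rmorph1 mul1r add0r.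
by rewrite -[1](expr1n _ 2); apply: sum_sq_sqr.
Qed.

Definition maximal_qmod Q := [/\ qmod Q, ~ Q (-1) &
  forall Q', qmod Q' -> ~ Q' (-1) -> Q `<=` Q' -> Q' `<=` Q].

Lemma exists_maximal_qmod M : qmod M -> ~ M (-1) ->
  exists2 Q, maximal_qmod Q & M `<=` Q.
Proof.
move=> qM Mproper.
pose good X := [/\ qmod X, ~ X (-1) & M `<=` X].
have [F Fgood totF|Q [+ Qmax]] := @Zorn_bigcup T [set X | X = set0 \/ good X].
  have [[X FX gX]|noX] := pselect (exists2 X, F X & good X); last first.
    left; rewrite -subset0 => w [Y FY Yw].
    case: (Fgood _ FY) => [Y0|gY]; first by rewrite Y0 in Yw.
    by apply: noX; exists Y.
  right; case: (gX) => [[X1 _ _] _ MX]; split.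
  - split; first by exists X.
    + move=> u v [Y FY Yu] [Z FZ Zv].
      have gd W w : F W -> W w -> good W.
        by move=> /Fgood [->|].
      have [YZ|ZY] := totF _ _ FY FZ.
        by exists Z => //; have [[_ ZD _] _ _] := gd _ _ FZ Zv; apply: ZD => //; apply: YZ.
      by exists Y => //; have [[_ YD _] _ _] := gd _ _ FY Yu; apply: YD => //; apply: ZY.
    + move=> a u [Y FY Yu]; exists Y => //.
      by case: (Fgood _ FY) Yu => [->|[[_ _ YM] _ _] Yu] //; apply: YM.
  - by move=> [Y FY]; case: (Fgood _ FY) => [->|[]].
  - by move=> w Mw; exists X => //; apply: MX.
have Qmax' Q' : good Q' -> Q `<=` Q' -> Q' `<=` Q.
  move=> gQ' QQ'; have [//|Q'Q] := pselect (Q' `<=` Q).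
  by exfalso; apply: (Qmax Q') => //; right.
case=> [Q0|[qQ Qproper MQ]].
  have : M `<=` Q by apply: Qmax'; [split | rewrite Q0].
  by rewrite Q0 => /(_ 1); case: qM => M1 _ _ /(_ M1).
exists Q => //; split=> // Q' qQ' Q'p QQ'; apply: Qmax' => //.
by split=> //; apply: subset_trans QQ'.
Qed.

(** * The state of a maximal module: linearity and multiplicativity *)

Section MaximalModule.
Variable Q : set T.
Hypotheses (Qmax : maximal_qmod Q) (archQ : archimedean_on Q).

Let qQ : qmod Q. Proof. by case: Qmax. Qed.
Let Qproper : ~ Q (-1). Proof. by case: Qmax. Qed.
Let QD u v : Q u -> Q v -> Q (u + v).
Proof. by case: qQ => _ + _; apply. Qed.

Lemma maximal_adjoin v : ~ Q v -> exists q s,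
  [/\ Q q, sum_sq s & -1 = q + j s * v].
Proof.
move=> nQv; apply: contrapT => proper; apply: nQv.
have [_ _ maxQ] := Qmax; apply: (maxQ (qmod_adjoin Q v)).
- exact: qmod_adjoinP.
- by [].
- exact: sub_qmod_adjoin.
- exact: qmod_adjoin_id.
Qed.

(** If both fail, cross-multiplying the two certificates of -1 eliminates [v] and puts -s1 in [Q].
    With C + v in [Q], also s1 v = s1 (C + v) - C s1 is in [Q], and the first certificate gives -1
    in [Q]. *)
Lemma maximal_total v : V v -> Q v \/ Q (- v).
Proof.
move=> Vv; have [|nQv] := pselect (Q v); first by left.
have [|nQNv] := pselect (Q (- v)); first by right.
have [q1 [s1 [Qq1 ss1 e1]]] := maximal_adjoin nQv.
have [q2 [s2 [Qq2 ss2 e2]]] := maximal_adjoin nQNv.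
have [Q1 _ _] := qQ.
have Qs s : sum_sq s -> Q (j s).
  by move=> ss; rewrite -[j s]mulr1; apply: qmod_sumsq.
have QNs1 : Q (- j s1).
  have -> : - j s1 = j s2 * q1 + j s1 * q2 + j s2.
    have -> : q1 = - 1 - j s1 * v by rewrite e1 addrK.
    have -> : q2 = - 1 + j s2 * v by rewrite e2 mulrN addrNK.
    ring.
  by apply/QD; [apply/QD; apply: qmod_sumsq | apply: Qs].
have [C [C0 QCv _]] := archQ Vv.
exfalso; apply: Qproper; rewrite e1; apply/QD => //.
have -> : j s1 * v = j s1 * (j (i C) + v) + j (i C) * - j s1 by ring.
by apply/QD; [apply: qmod_sumsq | apply: qmod_scale => //; apply: ltW].
Qed.

(** This is the character phi of the overview. Outside [V] the set may have no supremum and [sup] is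
    then a default value, hence the hypotheses [V v] below. *)
Definition state v : R := sup [set c | Q (v - j (i c))].

Let Qcomp v w : Q (v - w) -> forall u, Q (w - u) -> Q (v - u).
Proof. by move=> Qvw u Qwu; rewrite -(subrKA w); apply/QD. Qed.

Let Qle c d v : Q (v - j (i c)) -> Q (j (i d) - v) -> c <= d.
Proof.
move=> Qc Qd; rewrite -subr_ge0; apply: (qmod_proper_const qQ Qproper).
by rewrite !rmorphB; apply: Qcomp Qc.
Qed.

Let state_has_sup v : V v -> has_sup [set c | Q (v - j (i c))].
Proof.
move=> /archQ [N [N0 QN1 QN2]]; split.
  by exists (- N); rewrite /= !rmorphN opprK addrC.
by exists N => c /= Qc; apply: Qle QN2.
Qed.

Lemma state_ge c v : V v -> Q (v - j (i c)) -> c <= state v.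
Proof. by move=> Vv Qc; apply: sup_upper_bound => //; apply: state_has_sup. Qed.

Lemma state_le c v : V v -> Q (j (i c) - v) -> state v <= c.
Proof.
move=> Vv Qc; apply: ge_sup; first by case: (state_has_sup Vv).
by move=> d /= Qd; apply: Qle Qc.
Qed.

Lemma state_lower c v : V v -> c < state v -> Q (v - j (i c)).
Proof.
move=> Vv /sup_gt [|d /= Qd cd]; first by case: (state_has_sup Vv).
apply: Qcomp Qd _ _; rewrite -!rmorphB; apply: qmod_const => //.
by rewrite subr_ge0 ltW.
Qed.

(** Totality enters here: the alternative v - c in [Q] would force c to be at most [state v]. *)
Lemma state_upper c v : V v -> state v < c -> Q (j (i c) - v).
Proof.
move=> Vv vc; have [|Qc|] := maximal_total (v := v - j (i c)).
- by apply: VD => //; apply/V_opp/V_range.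
- by have := state_ge Vv Qc; rewrite leNgt vc.
- by rewrite opprB.
Qed.

(** The supremum need not be attained, so values are identified up to an arbitrary margin [e]. *)
Lemma state_eq c v : V v -> (forall e, 0 < e ->
  Q (v - j (i (c - e))) /\ Q (j (i (c + e)) - v)) -> state v = c.
Proof.
move=> Vv Qc; apply/eqP; rewrite eq_le; apply/andP; split.
  by apply/ler_addgt0Pr => e /Qc [_ Qe]; apply: state_le.
by apply/ler_addgt0Pr => e /Qc [Qe _]; rewrite -lerBlDr; apply: state_ge.
Qed.

Lemma state_near v e : V v -> 0 < e ->
  Q (v - j (i (state v - e))) /\ Q (j (i (state v + e)) - v).
Proof.
move=> Vv e0; split; first by apply: state_lower => //; rewrite ltrBlDr ltrDl.
by apply: state_upper => //; rewrite ltrDl.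
Qed.

Lemma state_ge0 v : V v -> Q v -> 0 <= state v.
Proof. by move=> Vv Qv; apply: state_ge => //; rewrite !rmorph0 subr0. Qed.

Lemma state_const c : state (j (i c)) = c.
Proof.
apply: state_eq; first exact: V_range.
move=> e e0; rewrite -!rmorphB; split; apply: qmod_const => //.
  by rewrite opprB addrC subrK ltW.
by rewrite addrC addKr ltW.
Qed.

Lemma stateD u v : V u -> V v -> state (u + v) = state u + state v.
Proof.
move=> Vu Vv; apply: state_eq; first exact: VD.
move=> e e0; have e20 : 0 < e / 2 by rewrite divr_gt0.
have [Qu1 Qu2] := state_near Vu e20; have [Qv1 Qv2] := state_near Vv e20.
split.
  have -> : state u + state v - e = (state u - e / 2) + (state v - e / 2).
    by field.
  by rewrite [i _]rmorphD [j _]rmorphD opprD addrACA; apply/QD.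
have -> : state u + state v + e = (state u + e / 2) + (state v + e / 2).
  by field.
by rewrite [i _]rmorphD [j _]rmorphD opprD addrACA; apply/QD.
Qed.

Lemma stateZ c v : V v -> state (j (i c) * v) = c * state v.
Proof.
(* Only nonnegative constants preserve [Q]; negative ones follow from additivity. *)
suff pos b : 0 < b -> V v -> state (j (i b) * v) = b * state v.
  have [c0|c0|->] := ltgtP c 0; first last.
  - by rewrite !rmorph0 mul0r -[X in state X](rmorph0 j) -[X in j X](rmorph0 i) state_const mul0r.
  - exact: pos.
  move=> Vv; have c0' : 0 < - c by rewrite oppr_gt0.
  apply/eqP; rewrite -subr_eq0 -mulNr -pos // -stateD; [|exact: VM..].
  rewrite !rmorphN mulNr subrr.
  by rewrite -[X in state X](rmorph0 j) -[X in j X](rmorph0 i) state_const.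
move=> b0 Vv; apply: state_eq; first exact: VM.
move=> e e0; have e20 : 0 < e / b by rewrite divr_gt0.
have b0' : b != 0 by rewrite gt_eqF.
have [Q1 Q2] := state_near Vv e20.
split.
  have -> : b * state v - e = b * (state v - e / b) by field.
  rewrite [i (b * _)]rmorphM [j (_ * _)]rmorphM -mulrBr.
  by apply: qmod_scale => //; apply: ltW.
have -> : b * state v + e = b * (state v + e / b) by field.
rewrite [i (b * _)]rmorphM [j (_ * _)]rmorphM -mulrBr.
by apply: qmod_scale => //; apply: ltW.
Qed.

Lemma stateN v : V v -> state (- v) = - state v.
Proof.
by move=> Vv; have := stateZ (-1) Vv; rewrite !rmorphN1 !mulN1r.
Qed.

(** For every t > 0, [Q] places a between -t and t, and v between -C and C, so a v should exceed
    -3tC. Since [qmod] gives no closure under products, an explicit certificate is needed. *)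
Let state_mul0_ge a v : V v -> state (j a) = 0 -> 0 <= state (j a * v).
Proof.
move=> Vv a0; have [C [C0 QC1 QC2]] := archQ Vv.
have Vav : V (j a * v) by exact: VM.
apply/ler_addgt0Pr => e e0; rewrite -lerBlDr sub0r.
(* This choice makes the error 3tC equal to [e]. *)
pose t := e / (3 * C).
have t0 : 0 < t by rewrite divr_gt0 // mulr_gt0.
have [] := state_near (V_range a) t0; rewrite a0 sub0r add0r => Qa1 Qa2.
apply: state_ge => //.
rewrite -[e](@divfK _ (3 * C)) ?mulf_neq0 ?gt_eqF// -/t.
rewrite !rmorphN ?opprK in Qa1 *; rewrite ?opprK.
have t20 : 0 < 2 * t by rewrite mulr_gt0.
apply: (qmod_unscale qQ t20).
(* 2t(av + 3tC) = (a + t)^2 (C + v) + a^2 (C - v) + t^2 (C - v)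
   + 2C(t^2 - a^2) + 2tC(t - a), and t^2 - a^2 lies in Q because
   2t(t^2 - a^2) = (t - a)^2 (a + t) + (t + a)^2 (t - a). *)
have -> : j (i (2 * t)) * (j a * v + j (i (t * (3 * C)))) =
    j (a + i t) ^+ 2 * (j (i C) + v) + j a ^+ 2 * (j (i C) - v)
    + j (i t) ^+ 2 * (j (i C) - v)
    + j (i C) * (j (i (t^-1)) * (j (i t - a) ^+ 2 * (j a + j (i t))
                               + j (i t + a) ^+ 2 * (j (i t) - j a)))
    + j (i (2 * (t * C))) * (j (i t) - j a).
  have tt : j (i (t^-1)) * j (i t) = 1.
    by rewrite -!rmorphM mulVf ?gt_eqF // !rmorph1.
  have -> : j (i t - a) ^+ 2 * (j a + j (i t)) +
    j (i t + a) ^+ 2 * (j (i t) - j a) =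
    j (i t) * (2 * (j (i t) ^+ 2 - j a ^+ 2)).
    by rewrite !(rmorphD, rmorphN); ring.
  rewrite [j (i t^-1) * _]mulrA tt mul1r.
  by ring.
have [_ _ QM] := qQ.
have QMM b c u : 0 <= c -> Q u -> Q (j (i c) * (j b ^+ 2 * u)).
  by move=> c0 Qu; apply: qmod_scale => //; apply: QM.
apply/QD; last first.
  by apply: qmod_scale => //; rewrite !pmulr_rge0 ?ltW.
apply/QD; last first.
  apply: qmod_scale => //; first exact: ltW.
  apply: qmod_scale => //; first by rewrite invr_ge0 ltW.
  by apply/QD; apply: QM.
by apply/QD; [apply/QD|]; apply: QM.
Qed.

(** Subtracting from [a] its value leaves [b] with value 0; the preceding bound for v and for -v
    then shows that b v has value 0. *)
Lemma stateM a v : V v -> state (j a * v) = state (j a) * state v.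
Proof.
move=> Vv; pose b := a - i (state (j a)).
have b0 : state (j b) = 0.
  rewrite rmorphB stateD ?stateN ?state_const ?subrr//; try exact: V_range.
  exact/V_opp/V_range.
have bv0 : state (j b * v) = 0.
  apply/eqP; rewrite eq_le state_mul0_ge // andbT.
  rewrite -oppr_ge0 -stateN; last exact: VM.
  by rewrite -mulrN; apply: state_mul0_ge => //; apply: V_opp.
have -> : j a * v = j b * v + j (i (state (j a))) * v.
  by rewrite rmorphB -mulrDl subrK.
by rewrite stateD ?bv0 ?add0r ?stateZ//; apply: VM.
Qed.

End MaximalModule.

(* Either t p - 1 lies in M for some sum of squares t, and then so does p, or
   M and -p lie in a maximal module, whose state is a character with
   phi p <= 0. *)
Theorem restricted_positivstellensatz M p : qmod M -> archimedean_on M ->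
  V p ->
  (forall phi : T -> R, (forall c, phi (j (i c)) = c) ->
     (forall u v, V u -> V v -> phi (u + v) = phi u + phi v) ->
     (forall a v, V v -> phi (j a * v) = phi (j a) * phi v) ->
     (forall v, V v -> M v -> 0 <= phi v) -> 0 < phi p) ->
  M p.
Proof.
move=> qM archM Vp phi_pos; apply: contrapT => nMp.
have [||Q Qmax MQ] := @exists_maximal_qmod (qmod_adjoin M (- p)).
- exact: qmod_adjoinP.
- move=> [q [s [Mq ss e]]]; apply: nMp; apply: (archimedean_cancel _ _ _ ss) => //.
  by rewrite e mulrN [q - _]addrC addNKr.
have archQ : archimedean_on Q.
  move=> v /archM [N [N0 M1 M2]]; exists N.
  by split=> //; apply/MQ/sub_qmod_adjoin.
have : 0 < state Q p.
  apply: phi_pos.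
  - exact: state_const.
  - exact: stateD.
  - exact: stateM.
  - by move=> v Vv Mv; apply: state_ge0 => //; apply/MQ/sub_qmod_adjoin.
apply/negP; rewrite -leNgt -oppr_ge0 -stateN //.
by apply: state_ge0 => //; [exact: V_opp | exact/MQ/qmod_adjoin_id].
Qed.

End QuadraticModules.

Lemma meval_sum (n : nat) (A : comNzRingType) (v : 'I_n -> A) (I : Type)
    (s : seq I) (F : I -> {mpoly A[n]}) :
  (\sum_(k <- s) F k).@[v] = \sum_(k <- s) (F k).@[v].
Proof. exact: (raddf_sum (meval v)). Qed.

(** * Polynomials affine in lambda, and their characters as point evaluations *)

Section AffinePolynomials.
Variables (R : realType) (n r : nat).


Lemma affine_lambdaC (a : {mpoly R[n]}) : affine_lambda (a%:MP : {xlpoly R[n, r]}).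
Proof.
exists a, (fun=> 0); rewrite big1 ?addr0// => k _.
by rewrite mpolyC0 mulr0.
Qed.

Lemma affine_lambdaX k : affine_lambda ('X_k : {xlpoly R[n, r]}).
Proof.
exists 0, (fun l => (l == k)%:R); rewrite mpolyC0 add0r (bigD1 k)//=.
rewrite eqxx mpolyC1 mulr1 big1 ?addr0// => l /negPf ->.
by rewrite mpolyC0 mulr0.
Qed.

Lemma affine_lambdaD (u v : {xlpoly R[n, r]}) :
  affine_lambda u -> affine_lambda v -> affine_lambda (u + v).
Proof.
move=> [u0 [p ->]] [v0 [q ->]]; exists (u0 + v0), (fun k => p k + q k).
rewrite mpolyCD addrACA -big_split /=; congr (_ + _).
by apply: eq_bigr => k _; rewrite mpolyCD mulrDr.
Qed.

Lemma affine_lambdaM (a : {mpoly R[n]}) (v : {xlpoly R[n, r]}) :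
  affine_lambda v -> affine_lambda (a%:MP * v).
Proof.
move=> [v0 [q ->]]; exists (a * v0), (fun k => a * q k).
rewrite mpolyCM mulrDr mulr_sumr; congr (_ + _).
by apply: eq_bigr => k _; rewrite mpolyCM mulrCA.
Qed.

Lemma evalxlE (p0 : {mpoly R[n]}) (q : 'I_r -> {mpoly R[n]}) x l :
  evalxl (p0%:MP + \sum_(k < r) 'X_k * (q k)%:MP) x l =
  p0.@[x ord0] + \sum_(k < r) l ord0 k * (q k).@[x ord0].
Proof.
rewrite /evalxl mevalD mevalC mevalD; congr (_ + _).
rewrite (meval_sum (fun k => (l ord0 k)%:MP)) meval_sum; apply: eq_bigr => k _.
by rewrite mevalM mevalXU mevalC mevalM mevalC.
Qed.

Lemma mpoly_characterE (h : {mpoly R[n]} -> R) :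
  (forall c, h c%:MP = c) -> {morph h : a b / a + b} ->
  {morph h : a b / a * b} -> forall a, h a = a.@[fun k => h 'X_k].
Proof.
move=> hC hD hM.
have hXn a e : h (a ^+ e) = h a ^+ e.
  elim: e => [|e IH]; first by rewrite !expr0 -mpolyC1 hC.
  by rewrite !exprS hM IH.
have hX (m : 'X_{1..n}) : h 'X_[m] = \prod_k h 'X_k ^+ m k.
  rewrite mpolyXE_id (big_morph h hM (_ : h 1 = 1)).
    by apply: eq_bigr => k _; rewrite hXn.
  by rewrite -mpolyC1 hC.
elim/mpolyind => [|c m a _ _ IH]; first by rewrite -mpolyC0 hC mevalC.
by rewrite hD mevalD IH mevalZ mevalX -mul_mpolyC hM hC hX.
Qed.

(** Each term of an affine polynomial is a polynomial in x times 1 or some lambda_k, so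
    multiplicativity for one factor in R[x] suffices. On R[x] itself phi is an algebra character. *)
Lemma affine_characterE (phi : {xlpoly R[n, r]} -> R) :
  (forall c : R, phi c%:MP%:MP = c) ->
  (forall u v, affine_lambda u -> affine_lambda v ->
     phi (u + v) = phi u + phi v) ->
  (forall a v, affine_lambda v -> phi (a%:MP * v) = phi a%:MP * phi v) ->
  forall v, affine_lambda v ->
    phi v = evalxl v (\row_k phi ('X_k)%:MP) (\row_k phi 'X_k).
Proof.
move=> phiC phiD phiM _ [p0 [q ->]]; rewrite evalxlE.
have phiA a : phi a%:MP = a.@[(\row_k phi ('X_k)%:MP) ord0].
  rewrite (@mpoly_characterE (fun a => phi a%:MP)).
  - by apply: meval_eq => k; rewrite mxE.
  - exact: phiC.
  - by move=> b c; rewrite mpolyCD; apply: phiD; apply: affine_lambdaC.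
  - by move=> b c; rewrite mpolyCM; apply: phiM; apply: affine_lambdaC.
have Vterm k : affine_lambda ('X_k * (q k)%:MP : {xlpoly R[n, r]}).
  by rewrite mulrC; apply/affine_lambdaM/affine_lambdaX.
have V0 : affine_lambda (0 : {xlpoly R[n, r]}).
  by rewrite -mpolyC0; apply: affine_lambdaC.
rewrite phiD //; [|exact: affine_lambdaC|]; last first.
  by apply: (big_ind (@affine_lambda R n r)) => //; apply: affine_lambdaD.
congr (_ + _); first exact: phiA.
(* Additivity of [phi] holds only on affine polynomials, so affineness is carried along the partial
   sums. *)
pose K (u : {xlpoly R[n, r]}) (c : R) := affine_lambda u /\ phi u = c.
suff [] : K (\sum_(k < r) 'X_k * (q k)%:MP)
  (\sum_(k < r) (\row_k phi 'X_k) ord0 k * (q k).@[(\row_k phi ('X_k)%:MP) ord0]).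
  by [].
apply: (big_ind2 K).
- by split=> //; rewrite -!mpolyC0 phiC.
- move=> u c v d [Vu <-] [Vv <-]; split; first exact: affine_lambdaD.
  exact: phiD.
- move=> k _; split=> //.
  by rewrite mulrC phiM ?phiA ?mxE 1?mulrC//; apply: affine_lambdaX.
Qed.

Lemma sos_meval_ge0 (s : {mpoly R[n]}) x : sos s -> 0 <= s.@[x].
Proof.
move=> [qs ->]; rewrite meval_sum; apply: sumr_ge0 => q _.
by rewrite rmorphXn; apply: sqr_ge0.
Qed.

(** * The restricted quadratic module and its truncations *)

Variables (m : nat) (g : 'I_m -> {xlpoly R[n, r]}).

Lemma evalxl_qmodule_ge0 p xl : qmodule g p -> feasible g xl ->
  0 <= evalxl p xl.1 xl.2.
Proof.
move=> [s0 [s [ss0 ss ->]]] Kxl; rewrite /evalxl mevalD mevalC mevalD.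
apply: addr_ge0; first exact: sos_meval_ge0.
rewrite (meval_sum (fun k => (xl.2 ord0 k)%:MP)) meval_sum; apply: sumr_ge0 => k _.
rewrite mevalM mevalC mevalM; apply: mulr_ge0; first exact: sos_meval_ge0.
exact: Kxl.
Qed.

Lemma qmodule_qmod : qmod (@mpolyC r {mpoly R[n]}) (qmodule g).
Proof.
split.
- exists 1, (fun=> 0); split.
  + by rewrite -[1](expr1n _ 2); apply: sum_sq_sqr.
  + by move=> _; apply: sum_sq0.
  + by rewrite mpolyC1 big1 ?addr0// => k _; rewrite mpolyC0 mul0r.
- move=> _ _ [s0 [s [ss0 ss ->]]] [t0 [t [st0 st ->]]].
  exists (s0 + t0), (fun k => s k + t k); split.
  + exact: sum_sqD.
  + by move=> k; apply: sum_sqD; [apply: ss | apply: st].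
  + rewrite mpolyCD addrACA -big_split /=; congr (_ + _).
    by apply: eq_bigr => k _; rewrite mpolyCD mulrDl.
- move=> a _ [s0 [s [ss0 ss ->]]].
  exists (a ^+ 2 * s0), (fun k => a ^+ 2 * s k); split.
  + exact: sum_sqM.
  + by move=> k; apply: sum_sqM; apply: ss.
  + rewrite mpolyCM rmorphXn mulrDr mulr_sumr; congr (_ + _).
    by apply: eq_bigr => k _; rewrite mpolyCM rmorphXn mulrA.
Qed.

Lemma qmodule_gen k : qmodule g (g k).
Proof.
exists 0, (fun l => (l == k)%:R); split; first exact: sum_sq0.
  (* A 0-1 indicator is its own square. *)
  by move=> l; rewrite -[(_ == _)]andbb -mulnb natrM; apply: sum_sq_sqr.
rewrite mpolyC0 add0r (bigD1 k)//= eqxx mpolyC1 mul1r big1 ?addr0// => l /negPf ->.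
by rewrite mpolyC0 mul0r.
Qed.

(** A character nonnegative on the affine part of the module is evaluation at a point. That point is
    feasible because each [g k] is affine and belongs to the module. *)
Lemma qmodule_positivstellensatz p : (forall k, affine_lambda (g k)) ->
  restricted_archimedean g -> affine_lambda p ->
  (forall xl, feasible g xl -> 0 < evalxl p xl.1 xl.2) -> qmodule g p.
Proof.
move=> Vg archg Vp p_pos.
apply: (@restricted_positivstellensatz R _ _ (@mpolyC n R) (@mpolyC r {mpoly R[n]})
  (@affine_lambda R n r)) => //.
- by rewrite -mpolyC1; apply: affine_lambdaC.
- exact: affine_lambdaD.
- exact: affine_lambdaM.
- exact: qmodule_qmod.
- move=> phi phiC phiD phiM phi_ge0.
  have phiE := affine_characterE phiC phiD phiM.
  rewrite phiE //.
  apply: (p_pos (\row_k phi ('X_k)%:MP, \row_k phi 'X_k)) => k /=.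
  by rewrite -phiE //; apply: phi_ge0 => //; apply: qmodule_gen.
Qed.

Lemma tqmodule_qmodule d : tqmodule g d `<=` qmodule g.
Proof.
move=> p [s0 [s [[ss0 _] ss ->]]]; exists s0, s; split=> // k.
by case: (ss k).
Qed.

Lemma subset_tqmodule d e : (d <= e)%N -> tqmodule g d `<=` tqmodule g e.
Proof.
move=> de p [s0 [s [[ss0 ds0] ss ->]]]; exists s0, s; split=> //.
  by split=> //; apply: (leq_trans ds0); rewrite leq_mul2l.
move=> k; case: (ss k) => ssk dk; split=> //; apply: (leq_trans dk).
by rewrite leq_mul2l leq_sub2r ?orbT.
Qed.

Lemma qmodule_tqmodule p : qmodule g p -> exists d, tqmodule g d p.
Proof.
move=> [s0 [s [ss0 ss ->]]].
(* A crude bound for all degrees at once; including [halfdegx (g k)] leaves at least [tdeg (s k)]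
   after the subtraction. *)
exists (tdeg s0 + \sum_(k < m) (halfdegx (g k) + tdeg (s k)))%N, s0, s; split=> //.
  by split=> //; rewrite mul2n -addnn -addnA leq_addr.
move=> k; split=> //; rewrite mul2n -addnn; apply: leq_trans (leq_addr _ _).
have led : (halfdegx (g k) + tdeg (s k) <=
    tdeg s0 + \sum_(l < m) (halfdegx (g l) + tdeg (s l)))%N.
  by rewrite (bigD1 k)//= addnCA leq_addr.
by rewrite leq_subRL //; apply: leq_trans led; apply: leq_addr.
Qed.

Lemma fsup_nondecreasing f :
  {homo fsup f g : d e / (d <= e)%N >-> (d <= e)%E}.
Proof.
move=> d e de; apply: ereal_sup_le => _ [c Mc <-]; exists c => //.
exact: (subset_tqmodule de).
Qed.

Lemma evalxlBC f (c : R) (x : 'rV_n) (l : 'rV_r) :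
  evalxl (f - c%:MP%:MP) x l = evalxl f x l - c.
Proof. by rewrite /evalxl mevalB mevalB !mevalC. Qed.

Lemma fsup_le_fmin f d : (fsup f g d <= fmin f g)%E.
Proof.
apply: ge_ereal_sup => _ [c Mc <-].
apply: le_ereal_inf_tmp => _ [xl Kxl <-]; rewrite lee_fin -subr_ge0 -evalxlBC.
by apply: evalxl_qmodule_ge0 Kxl; apply: tqmodule_qmodule Mc.
Qed.

(** Below the infimum f - c is strictly positive on K, so it has a certificate, whose degree is
    finite. *)
Lemma fsup_ge_lt_fmin f (c : R) : affine_lambda f ->
  (forall k, affine_lambda (g k)) -> restricted_archimedean g ->
  (c%:E < fmin f g)%E -> exists d, (c%:E <= fsup f g d)%E.
Proof.
move=> Vf Vg archg cf.
have [|d Md] := @qmodule_tqmodule (f - c%:MP%:MP); last first.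
  by exists d; apply: ereal_sup_ubound; exists c.
apply: qmodule_positivstellensatz => //.
  by apply: affine_lambdaD => //; rewrite -!mpolyCN; apply: affine_lambdaC.
move=> xl Kxl; rewrite evalxlBC subr_gt0 -lte_fin.
by apply: lt_le_trans cf _; apply: ereal_inf_lbound; exists xl.
Qed.

End AffinePolynomials.

Theorem theorem5p1 (R : realType) (n r m : nat)
    (f : {xlpoly R[n, r]}) (g : 'I_m -> {xlpoly R[n, r]})
    (f_affine : affine_lambda f) (g_affine : forall i, affine_lambda (g i))
    (K_nonempty : feasible g !=set0) :
  (forall d : nat, (dmin f g <= d)%N ->
     (fsup f g d <= fsup f g d.+1)%E /\ (fsup f g d.+1 <= fmin f g)%E) /\
  (restricted_archimedean g -> fsup f g d @[d --> \oo] --> fmin f g).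
Proof.
split=> [d _|archg].
  by split; [exact: fsup_nondecreasing | exact: fsup_le_fmin].
suff -> : fmin f g = ereal_sup (range (fsup f g)).
  exact/ereal_nondecreasing_cvgn/fsup_nondecreasing.
apply/eqP; rewrite eq_le; apply/andP; split; last first.
  by apply: ge_ereal_sup => _ [d _ <-]; apply: fsup_le_fmin.
have [xl Kxl] := K_nonempty.
(* Nonemptiness of K excludes the value +oo; the value -oo makes the inequality trivial. *)
have : (fmin f g < +oo)%E.
  by apply: le_lt_trans (ltry (evalxl f xl.1 xl.2)); apply: ereal_inf_lbound; exists xl.
case fminE: (fmin f g) => [c| |] // _; last exact: leNye.
apply/lee_addgt0Pr => e e0; rewrite -leeBlDr// -EFinB.
(* The margin [e] is needed because f - c may vanish on K. *)
have [|d] := @fsup_ge_lt_fmin _ _ _ _ g f (c - e) f_affine g_affine archg.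
  by rewrite fminE lte_fin ltrBlDr ltrDl.
by move=> /le_trans; apply; apply: ereal_sup_ubound; exists d.
Qed.
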